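(* In the preemptive mUETS problem, the following online algorithm is $O(\log m/\log\log m)$-competitive. Let $q$ be the integer with $q^q\ge m>(q-1)^{q-1}$, compute an $m$-partition $(X_1,\dots,X_m)$ of $J$ minimizing $\max_{i\in[m]}c(X_i)$, set $k^*=\lfloor\log_q m\rfloor+1$ and $I^{(0)}=[m]$. For each phase $k=1,2,\dots,k^*$: for each $i\in I^{(k-1)}$, assign the batch of uncompleted jobs of $X_i$ to its own set of $q^{k-1}$ machines; continue processing until the number of uncompleted batches becomes $\lfloor m/q^k\rfloor$ (if several batches complete simultaneously so that the number would drop below $\lfloor m/q^k\rfloor$, ties are broken arbitrarily and the excess batches are treated as uncompleted and deferred to the next phase), then preempt all remaining uncompleted batches; let $I^{(k)}$ be the set of indices of uncompleted batches.
   Context: Preemptive mUETS: a finite set $J$ of $n$ jobs and $m$ identical machines, $n\ge m\ge 2$, all jobs available at time $0$. A known setup-time function $c:2^J\to\mathbb{R}_{\ge0}$ is monotone ($c(X)\le c(Y)$ for $X\subseteq Y$) and subadditive ($c(X)+c(Y)\ge c(X\cup Y)$ for disjoint $X,Y$). Each job $j$ has execution time $p_j\ge0$, unknown to an online algorithm until $j$ completes; $p(X)=\sum_{j\in X}p_j$. An algorithm forms batches (sets of jobs not completed and not assigned elsewhere) and may assign a batch $X$ to $k\ge1$ idle machines; each of these machines incurs setup time $c(X)$ and the jobs of $X$ are executed first-come first-served among them, so if uninterrupted the batch is completed between $c(X)+p(X)/k$ and $c(X)+p(X)/k+\max_{j\in X}p_j$ time units after it starts. Processing may be preempted: if a batch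 $X$ on $k$ machines is preempted $t$ time units after its start, the machines become available after at most $c(X)+\max_{j\in X}p_j$ further time units, the set $X'\subseteq X$ of completed jobs satisfies $c(X)+p(X')/k+\max_{j\in X}p_j\ge t$, completed jobs need not be reprocessed, and uncompleted jobs may be regrouped into new batches (incurring setup again). The makespan is the completion time of all jobs. The optimal makespan is $\min_{(X_1,\dots,X_m)\text{ partition of }J}\max_i(c(X_i)+p(X_i))$. An algorithm is $\rho$-competitive if its makespan is at most $\rho$ times the optimal makespan on every instance; $O(\log m/\log\log m)$-competitive means there is an absolute constant $C$ such that this holds with $\rho=C\log m/\log\log m$ (for $m$ large enough that this is positive). *)

(* Defs.v *)
(* MathComp + MathComp-Analysis; the reals are an arbitrary R : realType. *)
From HB Require Import structures.
From mathcomp Require Import all_boot all_order all_algebra.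
From mathcomp Require Import reals exp.

Set Implicit Arguments.
Unset Strict Implicit.
Unset Printing Implicit Defensive.

Import Order.TTheory GRing.Theory Num.Theory.
Local Open Scope ring_scope.

Section Model.
Variables (R : realType) (J : finType) (m : nat).
Variables (c : {set J} -> R) (p : J -> R).

Definition monotone_setup : Prop :=
  forall X Y : {set J}, X \subset Y -> c X <= c Y.

Definition subadditive_setup : Prop :=
  forall X Y : {set J}, [disjoint X & Y] -> c (X :|: Y) <= c X + c Y.

Record muets_instance : Prop := MuetsInstance {
  inst_machines : (2 <= m)%N;
  inst_jobs : (m <= #|J|)%N;
  inst_setup_ge0 : forall X : {set J}, 0 <= c X;
  inst_setup_mono : monotone_setup;
  inst_setup_sub : subadditive_setup;
  inst_exec_ge0 : forall j : J, 0 <= p j }.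

Definition ptotal (X : {set J}) : R := \sum_(j in X) p j.

(* Execution times, setup times and loads are nonnegative in an instance, so 0
   is a neutral starting value for this maximum and those below. *)
Definition pmax (X : {set J}) : R := \big[Num.max/0]_(j in X) p j.

(* Parts may be empty (idle machines). *)
Definition mpartition (X : 'I_m -> {set J}) : Prop :=
  (forall i i' : 'I_m, i != i' -> [disjoint X i & X i'])
  /\ \bigcup_(i < m) X i = [set: J].

Definition max_load (X : 'I_m -> {set J}) : R :=
  \big[Num.max/0]_(i < m) (c (X i) + ptotal (X i)).

(* A minimum: there are finitely many partitions, at least one if m > 0. *)
Definition opt_makespan : R :=
  inf (fun v : R =>
         exists X : 'I_m -> {set J}, mpartition X /\ v = max_load X).

Definition max_setup (X : 'I_m -> {set J}) : R :=
  \big[Num.max/0]_(i < m) c (X i).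

Definition min_setup_partition (X : 'I_m -> {set J}) : Prop :=
  mpartition X
  /\ forall Y : 'I_m -> {set J}, mpartition Y -> max_setup X <= max_setup Y.

(* D is a possible time needed by batch X on k machines when it is not
   interrupted; its exact value depends on the first-come first-served order
   and on the unknown execution times. *)
Definition possible_duration (X : {set J}) (k : nat) (D : R) : Prop :=
  c X + ptotal X / k%:R <= D <= c X + ptotal X / k%:R + pmax X.

(* Possible outcome of preempting batch X on k machines t time units after its
   start: Y is the set of completed jobs, and the machines become available
   d time units after the preemption. *)
Definition possible_preemption (X : {set J}) (k : nat) (t : R)
    (Y : {set J}) (d : R) : Prop :=
  [/\ Y \subset X,
      t <= c X + ptotal Y / k%:R + pmax X
    & 0 <= d <= c X + pmax X].

Record state := State {
  clock : R;                  (* all machines are idle from this time on *)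
  active : {set 'I_m};        (* I^(k), after k phases *)
  todo : 'I_m -> {set J} }.   (* uncompleted jobs of each part X_i *)

Definition init_state (X : 'I_m -> {set J}) : state := State 0 [set: 'I_m] X.

(* tau is the first time at which at most r of the batches indexed by I, whose
   uninterrupted durations are D, are still uncompleted. *)
Definition stop_time (I : {set 'I_m}) (D : 'I_m -> R) (r : nat) (tau : R)
    : Prop :=
  [/\ 0 <= tau,
      (#|[set i in I | (tau < D i)%R]| <= r)%N
    & forall t : R, 0 <= t < tau -> (r < #|[set i in I | (t < D i)%R]|)%N].

(* Phase k >= 1, leading from s to s'.  A i is the set of machines given to
   batch i; D i its uninterrupted duration; the phase is stopped tau time units
   after its start.  Batches with D i = tau complete exactly at that time, and
   any of them may be kept in [active s'] to make its size exactly m / q^k; a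
   batch kept this way is handled as a preempted one.  Y i and d i are the
   outcome of preempting batch i.  The next phase starts as soon as all
   preempted machines are available again; when no batch is preempted, clock s'
   is the completion time of the last batch. *)
Definition phase (q k : nat) (s s' : state) : Prop :=
  exists (A : 'I_m -> {set 'I_m}) (D : 'I_m -> R) (tau : R)
         (Y : 'I_m -> {set J}) (d : 'I_m -> R),
  [/\ (forall i, i \in active s -> #|A i| = (q ^ k.-1)%N)
      /\ (forall i i', i \in active s -> i' \in active s -> i != i' ->
            [disjoint A i & A i']),
      (forall i, i \in active s ->
         possible_duration (todo s i) (q ^ k.-1) (D i))
      /\ stop_time (active s) D (m %/ q ^ k) tau,
      [/\ active s' \subset active s,
          #|active s'| = (m %/ q ^ k)%N,
          forall i, i \in active s -> tau < D i -> i \in active s'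
        & forall i, i \in active s' -> tau <= D i],
      [/\ forall i, i \in active s' ->
            possible_preemption (todo s i) (q ^ k.-1) tau (Y i) (d i),
          forall i, i \in active s' -> todo s' i = todo s i :\: Y i,
          forall i, i \in active s -> i \notin active s' -> todo s' i = set0
        & forall i, i \notin active s -> todo s' i = todo s i]
    & clock s' = clock s + tau + \big[Num.max/0]_(i in active s') d i].

(* [run q X k s]: s is a possible state after the first k phases. *)
Inductive run (q : nat) (X : 'I_m -> {set J}) : nat -> state -> Prop :=
| run_init : run q X 0 (init_state X)
| run_phase k s s' : run q X k s -> phase q k.+1 s s' -> run q X k.+1 s'.

(* With truncated predecessor, q = 0 is excluded for m >= 2 since 0 ^ 0 = 1. *)
Definition phase_base (q : nat) : Prop :=
  (m <= q ^ q)%N /\ (q.-1 ^ q.-1 < m)%N.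

(* trunc_log q m is the floor of log_q m. *)
Definition num_phases (q : nat) : nat := (trunc_log q m).+1.

Definition valid_parameters (q : nat) (X : 'I_m -> {set J}) : Prop :=
  phase_base q /\ min_setup_partition X.

Definition all_completed (s : state) : Prop := forall i : 'I_m, todo s i = set0.

(* On this instance the algorithm can always be carried out (its parameters
   exist and no phase can get stuck), and every possible execution completes
   all jobs by time rho * opt_makespan. *)
Definition algorithm_within (rho : R) : Prop :=
  [/\ exists (q : nat) (X : 'I_m -> {set J}), valid_parameters q X,
      forall (q : nat) (X : 'I_m -> {set J}) (k : nat) (s : state),
        valid_parameters q X -> (k < num_phases q)%N -> run q X k s ->
        exists s' : state, phase q k.+1 s s'
    & forall (q : nat) (X : 'I_m -> {set J}) (s : state),
        valid_parameters q X -> run q X (num_phases q) s ->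
        all_completed s /\ clock s <= rho * opt_makespan].

End Model.

Definition log_ratio (R : realType) (m : nat) : R := ln m%:R / ln (ln m%:R).

(* Main.v *)
(* Write B for the optimal makespan.  It bounds every execution time and every
   c(X_i), because the partition minimizes the largest setup time, and the total
   work is at most m B.  Suppose that phase k runs for tau >= 2 B.  More than
   m / q^k batches are uncompleted until tau, each on q^(k-1) machines, and each
   of them completes jobs of total length at least q^(k-1) (tau - 2 B).  Hence
   the phase reduces the remaining work by at least (m / q) (tau - 2 B), and the
   excesses tau - 2 B over all phases add up to at most q B.  The remaining
   costs, including the delay after preemption, are at most 4 B per phase, and
   there are at most q + 1 phases.  Finally (q - 1)^(q - 1) < m gives
   q = O(log m / log log m). *)
Require Import Defs.
From HB Require Import structures.
From mathcomp Require Import all_boot all_order all_algebra.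
From mathcomp Require Import reals exp.
From mathcomp Require Import lra.

Set Implicit Arguments.
Unset Strict Implicit.
Unset Printing Implicit Defensive.

Import Order.TTheory GRing.Theory Num.Theory.
Local Open Scope ring_scope.

(** * Finite sets of prescribed size *)

Lemma exists_set_between (T : finType) (A C : {set T}) (r : nat) :
  A \subset C -> (#|A| <= r <= #|C|)%N ->
  exists B : {set T}, [/\ A \subset B, B \subset C & #|B| = r].
Proof.
move=> sAC /andP[leAr lerC].
elim: r leAr lerC => [|r IH] leAr lerC.
  by exists A; split=> //; apply/eqP; rewrite -leqn0.
move: leAr; rewrite leq_eqVlt => /predU1P[eqA|ltA]; first by exists A.
have [B [sAB sBC cB]] := IH ltA (ltnW lerC).
have /subsetPn[x xC xB] : ~~ (C \subset B).
  by apply/negP => /subset_leq_card; rewrite cB leqNgt lerC.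
exists (x |: B); split.
- exact: subset_trans sAB (subsetUr _ _).
- by rewrite subUset sub1set xC.
- by rewrite cardsU1 xB cB.
Qed.

(** Provides the machine sets of a phase. The induction also carries the union [U] of the sets
    chosen so far, whose complement still has room for the next one. *)
Lemma exists_disjoint_sets (T : finType) (w n : nat) :
  (n * w <= #|T|)%N ->
  exists A : nat -> {set T},
    (forall i, (i < n)%N -> #|A i| = w)
    /\ (forall i j, (i < j < n)%N -> [disjoint A i & A j]).
Proof.
move=> len; suff [A [_ [? ? _ _]]] : exists (A : nat -> {set T}) (U : {set T}),
    [/\ forall i, (i < n)%N -> #|A i| = w,
        forall i j, (i < j < n)%N -> [disjoint A i & A j],
        forall i, (i < n)%N -> A i \subset U & #|U| = (n * w)%N] by exists A.
elim: n len => [|n IH] len.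
  by exists (fun=> set0), set0; split=> // [i j|]; rewrite ?andbF ?cards0.
have [|A [U [cA dA sA cU]]] := IH.
  exact: leq_trans (leq_mul (leqnSn n) (leqnn w)) len.
have [|B [_ sBU cB]] := @exists_set_between T set0 (~: U) w (sub0set _).
  rewrite cards0 (cardsCs (~: U)) setCK cU leq_subRL.
    by rewrite addnC -mulSn.
  by rewrite (leq_trans _ len) ?leq_mul.
exists (fun i => if i == n then B else A i), (B :|: U); split.
- by move=> i; rewrite ltnS leq_eqVlt; case: eqP => //= _ /cA.
- move=> i j /andP[ij]; rewrite ltnS => jn.
  rewrite (ltn_eqF (leq_trans ij jn)).
  have [ejn|njn] := eqVneq j n; last by apply: dA; rewrite ij ltn_neqAle njn.
  rewrite disjoint_sym disjoints_subset (subset_trans sBU) // setCS.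
  by apply: sA; apply: leq_trans ij jn.
- move=> i; rewrite ltnS leq_eqVlt; case: eqP => //= _.
    by rewrite subsetUl.
  by move=> /sA /subset_trans; apply; apply: subsetUr.
- rewrite cardsU cB cU disjoint_setI0 ?cards0 ?subn0 ?mulSn //.
  by rewrite disjoints_subset.
Qed.

(** * Existence and properties of the stopping time *)

Section StopTime.
Variables (R : realType) (m : nat).
Implicit Types (I : {set 'I_m}) (D : 'I_m -> R) (r : nat) (tau : R).

(** Take [t] as the largest duration below [tau], or 0: no duration of [I] lies strictly between [t]
    and [tau]. *)
Lemma exists_last_before I D tau :
  0 < tau ->
  exists2 t : R, 0 <= t < tau &
    [set i in I | t < D i] = [set i in I | tau <= D i].
Proof.
move=> tau_gt0; set t := \big[Num.max/0]_(i in I | D i < tau) D i.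
have t_lt : t < tau by apply/bigmax_ltP; split=> // i /andP[].
exists t; first by rewrite t_lt andbT; apply: bigmax_ge_id.
apply/setP => i; rewrite !inE; case iI: (i \in I) => //=.
apply/idP/idP => [|tauD]; last exact: lt_le_trans tauD.
apply: contraTT; rewrite -ltNge -leNgt => Di.
by apply: le_bigmax_cond; rewrite iI.
Qed.

(** Just before [tau] more than [r] batches were uncompleted, and these are the batches with
    duration at least [tau]. The strict inequality later absorbs the rounding in [m %/ q ^ k]. *)
Lemma stop_time_card I D r tau :
  0 < tau -> stop_time I D r tau -> (r < #|[set i in I | (tau <= D i)%R]|)%N.
Proof.
move=> tau_gt0 [_ _].
by have [t ht <-] := exists_last_before I D tau_gt0; apply.
Qed.

Lemma stop_time_exists I D r :
  (forall i, i \in I -> 0 <= D i) -> exists tau : R, stop_time I D r tau.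
Proof.
move=> D_ge0.
pose late t := (#|[set i in I | (t < D i)%R]| <= r)%N.
(* The candidate times are 0, encoded by [None], and the durations; the maximum with 0 covers
   indices outside [I], where [D] may be negative. *)
pose f (o : option 'I_m) : R := if o is Some i then Num.max 0 (D i) else 0.
have [o lateo] : exists o, late (f o).
  suff [o fo] : exists o, forall i, i \in I -> D i <= f o.
    exists o; rewrite /late (_ : [set i in I | _] = set0) ?cards0 //.
    apply/setP=> i; rewrite !inE; apply/negP => /andP[iI].
    by rewrite ltNge fo.
  have [o _ fo] := @Order.TotalTheory.arg_maxP _ _ _ None predT f isT.
  exists o => i _; apply: le_trans (fo (Some i) isT).
    by rewrite le_max lexx orbT.
have [v latev minv] :=
  Order.TotalTheory.arg_minP (P := fun o => late (f o)) f lateo.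
have f_ge0 u : 0 <= f u by case: u => [i|] //=; rewrite le_max lexx.
exists (f v); split=> // t /andP[t_ge0 tv]; rewrite ltnNge; apply/negP => latet.
(* With [f u] the last candidate up to [t], no batch completes after [f u] and by time [t], so [f u]
   would already qualify, against the minimality of [f v]. *)
have [u fu maxu] :=
  @Order.TotalTheory.arg_maxP _ _ _ None (fun u => f u <= t) f t_ge0.
have /minv : late (f u).
  apply: leq_trans latet; apply: subset_leq_card; apply/subsetP => i.
  rewrite !inE => /andP[iI Di]; rewrite iI /= ltNge; apply/negP => Dt.
  have : f (Some i) <= t by rewrite ge_max t_ge0.
  move=> /maxu; apply/negP; rewrite -ltNge /=.
  by rewrite lt_max Di orbT.
by rewrite leNgt (le_lt_trans fu tv).
Qed.

(** The tie-breaking is possible: [r] lies between the numbers of batches with duration above [tau]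
    and at least [tau]. *)
Lemma stop_time_select I D r tau :
  (r <= #|I|)%N -> (forall i, i \in I -> 0 <= D i) -> stop_time I D r tau ->
  exists K : {set 'I_m},
    [/\ K \subset I, #|K| = r,
        forall i, i \in I -> tau < D i -> i \in K
      & forall i, i \in K -> tau <= D i].
Proof.
move=> rI D_ge0 stop; have [tau_ge0 lt_r _] := stop.
have ge_r : (r <= #|[set i in I | (tau <= D i)%R]|)%N.
  move: tau_ge0; rewrite le_eqVlt => /predU1P[tau0|tau_gt0].
    rewrite (_ : [set i in I | _] = I) //; apply/setP => i; rewrite !inE -tau0.
    by apply: andb_idr => /D_ge0.
  exact/ltnW/stop_time_card.
have [||K [sK Ks cK]] := @exists_set_between _ [set i in I | (tau < D i)%R]
    [set i in I | (tau <= D i)%R] r.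
- by apply/subsetP => i; rewrite !inE => /andP[-> /ltW].
- by rewrite lt_r.
have KP i : i \in K -> (i \in I) && (tau <= D i).
  by move/(subsetP Ks); rewrite inE.
exists K; split=> //.
- by apply/subsetP => i /KP/andP[].
- by move=> i iI Di; apply: (subsetP sK); rewrite inE iI.
- by move=> i /KP/andP[].
Qed.

End StopTime.

(** * Lower bounds on the optimum, and feasibility of the algorithm *)

Section Instance.
Variables (R : realType) (J : finType) (m : nat).
Variables (c : {set J} -> R) (p : J -> R).
Hypothesis inst : muets_instance m c p.
Implicit Types (S : {set J}) (X : 'I_m -> {set J}) (s : state R J m).

Let c_ge0 S : 0 <= c S := inst_setup_ge0 inst S.
Let p_ge0 j : 0 <= p j := inst_exec_ge0 inst j.

Let m_gt0 : (0 < m)%N := ltnW (inst_machines inst).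

Lemma ptotal_ge0 S : 0 <= ptotal p S.
Proof. exact: sumr_ge0. Qed.

Lemma pmax_ge0 S : 0 <= pmax p S.
Proof. exact: bigmax_ge_id. Qed.

Lemma ptotalD S S' : S' \subset S ->
  ptotal p (S :\: S') = ptotal p S - ptotal p S'.
Proof.
move=> sS; rewrite /ptotal [\sum_(j in S) _](big_setID S') /=.
by rewrite (setIidPr sS) addrAC subrr add0r.
Qed.

Lemma mpartition_exists : exists X, mpartition X.
Proof.
exists (fun i : 'I_m => if i == Ordinal m_gt0 then [set: J] else set0); split.
  move=> i i' ii'; rewrite -setI_eq0; case: (eqVneq i) => [i0|_].
    by rewrite -i0 (eq_sym i') (negPf ii') setI0.
  by rewrite set0I.
apply/setP => j; rewrite inE; apply/bigcupP.
by exists (Ordinal m_gt0); rewrite ?eqxx ?inE.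
Qed.

Lemma min_setup_partition_exists : exists X, min_setup_partition c X.
Proof.
pose part (f : {ffun 'I_m -> {set J}}) :=
  [forall i, forall i', (i != i') ==> [disjoint f i & f i']]
  && (\bigcup_(i < m) f i == [set: J]).
have partP (f : {ffun 'I_m -> {set J}}) :
    reflect (mpartition f) (part f).
  apply: (iffP andP) => [[/forallP dis /eqP cov]|[dis cov]]; split=> //.
  - by move=> i i'; move/forallP/(_ i')/implyP: (dis i).
  - by apply/forallP => i; apply/forallP => i'; apply/implyP/dis.
  - exact/eqP.
have part_ffun X : mpartition X -> part (finfun X).
  case=> dis cov; apply/partP; split=> [i i'|].
    by rewrite !ffunE; apply: dis.
  by rewrite -cov; apply: eq_bigr => i _; rewrite ffunE.
have [X0 /part_ffun partX0] := mpartition_exists.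
have [f /partP fpart fmin] :=
  Order.TotalTheory.arg_minP (P := part)
    (fun f : {ffun 'I_m -> {set J}} => max_setup c f) partX0.
exists f; split=> // Y /part_ffun /fmin /le_trans; apply.
by rewrite /max_setup; under eq_bigr do rewrite ffunE.
Qed.

(** Since the optimum is an infimum, this rests on the existence of a partition. *)
Lemma le_opt_makespan (b : R) :
  (forall X, mpartition X -> b <= max_load c p X) -> b <= opt_makespan m c p.
Proof.
move=> leb; apply: lb_le_inf => [|_ [X [Xpart ->]]]; last exact: leb.
by have [X Xpart] := mpartition_exists; exists (max_load c p X), X.
Qed.

Lemma load_le_max_load X i : c (X i) + ptotal p (X i) <= max_load c p X.
Proof. exact: le_bigmax. Qed.

Lemma ptotal_setT X :
  mpartition X -> ptotal p [set: J] = \sum_i ptotal p (X i).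
Proof. by case=> dis <-; rewrite /ptotal partition_disjoint_bigcup. Qed.

Lemma opt_makespan_ge0 : 0 <= opt_makespan m c p.
Proof. by apply: le_opt_makespan => X _; apply: bigmax_ge_id. Qed.

Lemma exec_le_opt j : p j <= opt_makespan m c p.
Proof.
apply: le_opt_makespan => X [_ cov].
have /bigcupP[i _ jX] : j \in \bigcup_(i < m) X i by rewrite cov inE.
apply: le_trans (load_le_max_load X i); rewrite -[leLHS]add0r lerD //.
by rewrite /ptotal (bigD1 j) //= lerDl sumr_ge0.
Qed.

Lemma pmax_le_opt S : pmax p S <= opt_makespan m c p.
Proof.
by apply: bigmax_le => [|j _]; [apply: opt_makespan_ge0|apply: exec_le_opt].
Qed.

Lemma setup_le_opt X i :
  min_setup_partition c X -> c (X i) <= opt_makespan m c p.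
Proof.
move=> [_ Xmin]; apply: le_opt_makespan => Y /Xmin XY.
apply: le_trans (le_bigmax 0 (fun i => c (X i)) i) (le_trans XY _).
by apply: le_bigmax2 => i' _; rewrite lerDl ptotal_ge0.
Qed.

(** The largest of the [m] loads is at least their average. *)
Lemma ptotal_le_opt : ptotal p [set: J] <= m%:R * opt_makespan m c p.
Proof.
rewrite -ler_pdivrMl ?ltr0n //; apply: le_opt_makespan => X Xpart.
rewrite ler_pdivrMl ?ltr0n // (ptotal_setT Xpart).
rewrite -[m in m%:R]card_ord mulr_natl -sumr_const ler_sum // => i _.
by apply: le_trans (load_le_max_load X i); rewrite lerDr.
Qed.

(** The least [q] with [m <= q ^ q] works; [m] itself is a candidate. *)
Lemma phase_base_exists : exists q, phase_base m q.
Proof.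
have [|q mq qmin] := @ex_minnP (fun q => m <= q ^ q)%N.
  by exists m; rewrite -[leqLHS]expn1 leq_pexp2l.
exists q; split=> //; case: q mq qmin => [|q] mq qmin.
  by rewrite leqNgt expn0 (inst_machines inst) in mq.
by rewrite ltnNge; apply/negP => /qmin; rewrite ltnn.
Qed.

Lemma phase_base_gt1 q : phase_base m q -> (1 < q)%N.
Proof.
by case: q => [|[|q]] // []; rewrite ?exp1n ?expn0 leqNgt (inst_machines inst).
Qed.

Lemma num_phases_le q : phase_base m q -> (num_phases m q <= q.+1)%N.
Proof.
move=> qm; have q_gt1 := phase_base_gt1 qm; rewrite ltnS -(leq_exp2l _ _ q_gt1).
by apply: leq_trans (proj1 qm); apply: trunc_logP.
Qed.

Lemma phase_exists q k s :
  (0 < q)%N -> #|active s| = (m %/ q ^ k)%N ->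
  exists s', phase c p q k.+1 s s'.
Proof.
move=> q_gt0 cs.
have [|A [cA dA]] := @exists_disjoint_sets 'I_m (q ^ k) #|active s|.
  by rewrite cs card_ord leq_trunc_div.
(* An outcome in which all durations are minimal and every preempted batch turns
   out to be complete. *)
pose D i := c (todo s i) + ptotal p (todo s i) / (q ^ k)%:R.
have D_ge0 i : i \in active s -> 0 <= D i.
  by move=> _; rewrite addr_ge0 ?divr_ge0 ?ptotal_ge0.
have [tau stop] := stop_time_exists (m %/ q ^ k.+1)%N D_ge0.
have [|K [sK cK gtK geK]] := stop_time_select _ D_ge0 stop.
  by rewrite cs expnS mulnC divnMA leq_div.
exists (State (clock s + tau + \big[Num.max/0]_(i in K) (0 : R)) K
   (fun i => if i \in active s then set0 else todo s i)).
(* Each active batch gets the machine set numbered by its rank in the enumeration of active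
   indices. *)
exists (fun i => A (index i (enum (active s)))), D, tau, (todo s), (fun=> 0).
have idx i : i \in active s -> (index i (enum (active s)) < #|active s|)%N.
  by move=> iI; rewrite cardE index_mem mem_enum.
split=> //.
- split=> [i /idx/cA //|i i' iI i'I ii'].
  case: (ltngtP (index i (enum (active s))) (index i' (enum (active s))))
    => lt.
  + by apply: dA; rewrite lt idx.
  + by rewrite disjoint_sym; apply: dA; rewrite lt idx.
  + move: ii'.
    rewrite -(nth_index i (s := enum (active s)) (x := i)) ?mem_enum //.
    by rewrite lt nth_index ?mem_enum // eqxx.
- split=> // i iI; rewrite /possible_duration lexx lerDl pmax_ge0 //.
- split=> /= [i iK|i iK|i iI _|i /negPf ->] //.
  + split=> //; first by apply: le_trans (geK i iK) _; rewrite lerDl pmax_ge0.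
    by rewrite lexx addr_ge0 ?pmax_ge0.
  + by rewrite (subsetP sK i iK) setDv.
  + by rewrite iI.
Qed.

(** * Time and work balance of one phase *)

Section Phase.
Variables (q k : nat) (s s' : state R J m) (B : R).
Hypothesis q_gt0 : (0 < q)%N.
Hypothesis step : phase c p q k.+1 s s'.
Hypothesis setup_le : forall i, c (todo s i) <= B.
Hypothesis pmax_le : forall S, pmax p S <= B.

Lemma phase_todo_sub i : todo s' i \subset todo s i.
Proof.
have [A [D [tau [Y [d [_ _ _ [_ td done idle] _]]]]]] := step.
case: (boolP (i \in active s)) => [iI|/idle -> //].
case: (boolP (i \in active s')) => [/td ->|/(done i iI) ->].
  exact: subsetDl.
exact: sub0set.
Qed.

(** The potential, [m] times the clock plus [q] times the remaining work, grows by at most [4 * B]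
    per machine: [2 * B] for the part of [tau] not matched by work and [2 * B] for the preemption
    delay. *)
Lemma phase_progress :
  m%:R * clock s' + q%:R * \sum_i ptotal p (todo s' i)
  <= m%:R * clock s + q%:R * \sum_i ptotal p (todo s i) + m%:R * (4 * B).
Proof.
have sub := phase_todo_sub.
have [A [D [tau [Y [d [_ [dur stop] _ [pre td done _] ->]]]]]] := step.
have B_ge0 : 0 <= B := le_trans (pmax_ge0 set0) (pmax_le set0).
have delay : \big[Num.max/0]_(i in active s') d i <= 2 * B.
  apply: bigmax_le => [|i /pre[_ _ /andP[_ /le_trans]]].
    by rewrite mulr_ge0.
  by apply; have := setup_le i; have := pmax_le (todo s i); lra.
have w_gt0 : 0 < (q ^ k)%:R :> R by rewrite ltr0n expn_gt0 q_gt0.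
(* A batch lasting until [tau] loses at most one setup and one longest job, hence [2 * B]; this
   holds whether it is preempted or completes at [tau]. *)
have work i : i \in active s -> tau <= D i ->
    (q ^ k)%:R * (tau - 2 * B) <= ptotal p (todo s i) - ptotal p (todo s' i).
  move=> iI tauD; rewrite -ler_pdivlMl //.
  have := setup_le i; have := pmax_le (todo s i).
  case: (boolP (i \in active s')) => [iI'|niI'].
    have [sY + _] := pre i iI'; rewrite td // ptotalD // subKr /= => *.
    by rewrite mulrC; lra.
  rewrite (done i iI niI') /ptotal big_set0 subr0 -/(ptotal p _).
  by have /andP[_] := dur i iI => /= *; rewrite mulrC; lra.
have progress : m%:R * (tau - 2 * B)
   <= q%:R * \sum_i (ptotal p (todo s i) - ptotal p (todo s' i)).
  have dec_ge0 i : 0 <= ptotal p (todo s i) - ptotal p (todo s' i).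
    by rewrite -ptotalD ?ptotal_ge0.
  have [small|large] := leP tau (2 * B).
    apply: le_trans (_ : 0 <= _); last by rewrite mulr_ge0 ?sumr_ge0.
    by rewrite mulr_ge0_le0 // subr_le0.
  have tau_gt0 : 0 < tau by apply: le_lt_trans large; rewrite mulr_ge0.
  set L := [set i in active s | (tau <= D i)%R].
  (* At least [m %/ q ^ k.+1 + 1] batches last until [tau], so multiplying by [q ^ k.+1] recovers
     all of [m]. *)
  have cL : (m <= q * (q ^ k * #|L|))%N.
    have qk_gt0 : (0 < q ^ k.+1)%N by rewrite expn_gt0 q_gt0.
    rewrite mulnA -expnS mulnC; apply: ltnW.
    apply: leq_trans (ltn_ceil m qk_gt0) _; rewrite leq_mul2r.
    by rewrite (stop_time_card tau_gt0 stop) orbT.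
  apply: le_trans (_ : q%:R * \sum_(i in L) (q ^ k)%:R * (tau - 2 * B) <= _).
    rewrite sumr_const -mulrnAl mulrA -mulrnA -natrM.
    by rewrite ler_wpM2r ?subr_ge0 ?(ltW large) // ler_nat.
  rewrite ler_wpM2l // [leRHS](bigID (mem L)) /=.
  rewrite -[leLHS]addr0 lerD ?sumr_ge0 //.
  by apply: ler_sum => i; rewrite inE => /andP[iI /(work i iI)].
have := ler_wpM2l (ler0n R m) delay.
by move: progress; rewrite sumrB; lra.
Qed.

End Phase.

Lemma run_invariant q X k s :
  valid_parameters c q X -> run c p q X k s ->
  [/\ #|active s| = (m %/ q ^ k)%N,
      forall i, todo s i \subset X i,
      forall i, i \notin active s -> todo s i = set0
    & m%:R * clock s + q%:R * \sum_i ptotal p (todo s i)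
      <= q%:R * \sum_i ptotal p (X i)
         + k%:R * (m%:R * (4 * opt_makespan m c p))].
Proof.
move=> [qm Xmin]; have q_gt0 := ltnW (phase_base_gt1 qm).
elim=> {k s} [|k s s' _ [cs sX s0 bnd] step].
  split=> //= [|i|]; first by rewrite cardsT card_ord expn0 divn1.
    by rewrite inE.
  by rewrite mulr0 mul0r add0r addr0.
have cle i : c (todo s i) <= opt_makespan m c p.
  exact: le_trans (inst_setup_mono inst (sX i)) (setup_le_opt i Xmin).
have := phase_progress q_gt0 step cle pmax_le_opt.
have sub := phase_todo_sub step.
have [A [D [tau [Y [d [_ _ [_ cs' _ _] [_ _ done idle] _]]]]]] := step.
split=> // [i|i niI'|].
- exact: subset_trans (sub i) (sX i).
- case: (boolP (i \in active s)) => [/done -> //|niI].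
  by rewrite idle // s0.
- by rewrite mulrSr mulrDl mul1r; lra.
Qed.

Lemma run_end q X s :
  valid_parameters c q X -> run c p q X (num_phases m q) s ->
  all_completed s /\ clock s <= (5 * q + 4)%:R * opt_makespan m c p.
Proof.
move=> val r; have [cs _ s0 bnd] := run_invariant val r.
have [qm Xmin] := val; have q_gt1 := phase_base_gt1 qm.
(* After the last phase [m < q ^ num_phases m q], so the quotient is 0. *)
have act0 : active s = set0.
  by apply: cards0_eq; rewrite cs divn_small // trunc_log_ltn.
have td0 i : todo s i = set0 by apply: s0; rewrite act0 inE.
split=> //; have opt_ge0 := opt_makespan_ge0.
have M : 0 < m%:R :> R by rewrite ltr0n.
rewrite -(ler_pM2l M).
move: bnd; rewrite [\sum_i ptotal p (todo s i)]big1 => [|i _]; last first.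
  by rewrite td0 /ptotal big_set0.
rewrite mulr0 addr0 -(ptotal_setT (proj1 Xmin)) => /le_trans; apply.
have kq : (num_phases m q)%:R <= q.+1%:R :> R by rewrite ler_nat num_phases_le.
have mO : 0 <= m%:R * (4 * opt_makespan m c p) by rewrite !mulr_ge0.
(* The work term contributes [q] and the at most [q + 1] phases contribute 4 each, which gives
   [5 * q + 4]. *)
apply: le_trans
  (lerD (ler_wpM2l (ler0n _ q) ptotal_le_opt) (ler_wpM2r mO kq)) _.
by rewrite natrD natrM (mulrSr 1 q); lra.
Qed.

End Instance.

(** * Growth of the base against log m / log log m *)

Section Asymptotics.
Variables (R : realType) (m : nat).
Hypothesis m_gt1 : (1 < m)%N.
Hypothesis ratio_gt0 : 0 < log_ratio R m.

Let L : R := ln m%:R.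

Lemma ln_gt1_lnln_gt0 : 1 < L /\ 0 < ln L.
Proof.
have L_gt0 : 0 < L by rewrite ln_gt0 // ltr1n.
have lnL_gt0 : 0 < ln L.
  by move: ratio_gt0; rewrite /log_ratio pmulr_rgt0 // invr_gt0.
split=> //; rewrite ltNge; apply/negP => /ln_le0.
by rewrite leNgt lnL_gt0.
Qed.

Lemma log_ratio_gt1 : 1 < log_ratio R m.
Proof.
have [L_gt1 lnL_gt0] := ln_gt1_lnln_gt0.
by rewrite /log_ratio ltr_pdivlMr // mul1r ln_sublinear // (lt_trans ltr01).
Qed.

(** To be applied with [a = q.-1]. Logarithms turn the hypothesis into a ln a <= [L], which suffices
    once ln [L] is at most 2 ln a. *)
Lemma le_log_ratio (a : nat) : (a ^ a < m)%N -> a%:R <= 2 * log_ratio R m.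
Proof.
move=> am; have [L_gt1 lnL_gt0] := ln_gt1_lnln_gt0.
have L_gt0 : 0 < L by apply: lt_trans L_gt1.
have [->|a_gt0] := posnP a; first by rewrite mulr_ge0 // ltW.
rewrite /log_ratio mulrA ler_pdivlMr // -/L.
have aR : 0 < a%:R :> R by rewrite ltr0n.
(* If a^2 <= L, use ln L = 2 ln (sqrt L) < 2 sqrt L; otherwise ln L < 2 ln a. *)
have [small|large] := leP (a%:R ^+ 2) L.
  set y := Num.sqrt L; have y_gt0 : 0 < y by rewrite sqrtr_gt0.
  have yL : y ^+ 2 = L by rewrite sqr_sqrtr ?ltW.
  have ay : a%:R <= y.
    by rewrite -(ler_pXn2r (n := 2)) ?nnegrE ?(ltW aR) ?(ltW y_gt0) // yL.
  rewrite -yL lnXn // mulrnAr -[leLHS]mulr_natl ler_wpM2l // expr2.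
  apply: ler_pM (ltW aR) _ ay (ltW (ln_sublinear y_gt0)).
  by move: lnL_gt0; rewrite -yL lnXn // pmulrn_lgt0 // => /ltW.
have lnL_le : ln L <= ln a%:R *+ 2.
  by rewrite -lnXn // ler_ln ?posrE ?exprn_gt0 // ltW.
have aL : a%:R * ln a%:R <= L.
  rewrite mulr_natl -lnXn // ler_ln ?posrE ?exprn_gt0 ?ltr0n ?(ltnW m_gt1) //.
  by rewrite -natrX ler_nat ltnW.
apply: le_trans (ler_wpM2l (ltW aR) lnL_le) _.
by rewrite mulrnAr -[leLHS]mulr_natl ler_wpM2l.
Qed.

End Asymptotics.

Theorem theorem9 (R : realType) :
  exists C : R, 0 < C /\
    forall (J : finType) (m : nat) (c : {set J} -> R) (p : J -> R),
      muets_instance m c p ->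
      0 < log_ratio R m ->
      algorithm_within m c p (C * log_ratio R m).
Proof.
(* With [a = q.-1], the factor [5 * q + 4] is [5 * a + 9]; here [a] is at most twice the ratio and
   the ratio exceeds 1, so 10 + 9 suffices. *)
exists 19; split=> // J m c p inst ratio_gt0.
have [q0 q0m] := phase_base_exists inst.
have [X0 X0min] := min_setup_partition_exists inst.
split; first by exists q0, X0.
  move=> q X k s val _ r; have [cs _ _ _] := run_invariant inst val r.
  apply: phase_exists cs => //.
  exact/ltnW/(phase_base_gt1 inst (proj1 val)).
move=> q X s val r; have [done clk] := run_end inst val r; split=> //.
apply: le_trans clk _; rewrite ler_wpM2r ?(opt_makespan_ge0 inst) //.
have [_ qm] := proj1 val.
have := le_log_ratio (inst_machines inst) ratio_gt0 qm.
have := log_ratio_gt1 (inst_machines inst) ratio_gt0.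
have := ltnW (phase_base_gt1 inst (proj1 val)).
case: q {val r done qm} => // q _ /=.
by rewrite natrD natrM (mulrSr 1 q); lra.
Qed.
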